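(* Let $s,x\in\mathbb{R}^6$ be such that $x\notin[s]$. Then $$S^{-1}_{\mathcal{D},L}(s,x):=\mathcal{D}\left(S_L^{-1}(s,x)\right)=-4\,\mathcal{Q}_{c,s}(x)^{-1}$$ and $$S^{-1}_{\mathcal{D},R}(s,x):=\left(S_R^{-1}(s,x)\right)\mathcal{D}=-4\,\mathcal{Q}_{c,s}(x)^{-1}.$$
   Context: $\mathbb{R}_5$ is the real Clifford algebra generated by $e_1,\dots,e_5$ with $e_i^2=-1$, $e_ie_j=-e_je_i$ for $i\ne j$. $\mathbb{R}^6$ is identified with paravectors $x=x_0+\underline{x}$, $\underline{x}=\sum_{i=1}^5x_ie_i$; $\overline{x}=x_0-\underline{x}$, $|x|^2=\sum_{i=0}^5x_i^2$. $\mathbb{S}=\{\underline{x}:|\underline{x}|=1\}$ and $[s]=\{s_0+J|\underline{s}|:J\in\mathbb{S}\}$. For $x\notin[s]$: $\mathcal{Q}_{c,s}(x)=s^2-2x_0s+|x|^2$, $S_L^{-1}(s,x)=(s-\overline{x})\mathcal{Q}_{c,s}(x)^{-1}$, $S_R^{-1}(s,x)=\mathcal{Q}_{c,s}(x)^{-1}(s-\overline{x})$. The Dirac operator acts in the variable $x$, from the left by $\mathcal{D}f=\partial_{x_0}f+\sum_{i=1}^5e_i\partial_{x_i}f$ and from the right by $f\mathcal{D}=\partial_{x_0}f+\sum_{i=1}^5(\partial_{x_i}f)e_i$. *)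

(* Defs.v *)
From HB Require Import structures.
From mathcomp Require Import all_boot all_order all_algebra all_field.
From mathcomp Require Import all_classical all_reals all_analysis.

Set Implicit Arguments.
Unset Strict Implicit.
Unset Printing Implicit Defensive.

Import Order.TTheory GRing.Theory Num.Theory.
Import numFieldNormedType.Exports.

Local Open Scope classical_set_scope.
Local Open Scope ring_scope.

(* The Clifford algebra R_n is the real vector space with one basis vector
   e_A = e_{i_1} ... e_{i_k} for every A = {i_1 < ... < i_k} in {set 'I_n}.
   The generator e_{i+1} of the usual numbering is e_A for A = [set i]. *)
Definition clifford (R : realType) (n : nat) : Type := 'rV[R]_(#|{set 'I_n}|).

HB.instance Definition _ (R : realType) n := NormedModule.on (clifford R n).
HB.instance Definition _ (R : realType) n :=
  Vector.copy (clifford R n) 'rV[R]_(#|{set 'I_n}|).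

Section CliffordProduct.
Context {R : realType} {n : nat}.
Implicit Types (A B C : {set 'I_n}) (a b c : clifford R n).

Definition symdiff A B : {set 'I_n} := (A :\: B) :|: (B :\: A).

Definition ccoef a A : R := a 0 (enum_rank A).

Definition blade A : clifford R n := delta_mx 0 (enum_rank A).

(* Sorting the word e_A e_B costs one sign for each pair i in A, j in B with
   j < i (transposition) and one for each i = j (square equal to -1), whence
   e_A e_B = csign A B e_(symdiff A B). *)
Definition csign A B : R := \prod_(i in A) \prod_(j in B | (j <= i)%N) (-1).

Definition cone : clifford R n := blade finset.set0.

Definition cmul a b : clifford R n :=
  \sum_A \sum_B (csign A B * ccoef a A * ccoef b B) *: blade (symdiff A B).

Lemma in_symdiff A B i : (i \in symdiff A B) = (i \in A) (+) (i \in B).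
Proof. by rewrite !inE; case: (i \in A); case: (i \in B). Qed.

Lemma symdiffA A B C : symdiff A (symdiff B C) = symdiff (symdiff A B) C.
Proof. by apply/setP => i; rewrite !in_symdiff addbA. Qed.

Lemma symdiff0l A : symdiff finset.set0 A = A.
Proof. by apply/setP => i; rewrite in_symdiff inE. Qed.

Lemma symdiff0r A : symdiff A finset.set0 = A.
Proof. by apply/setP => i; rewrite in_symdiff inE addbF. Qed.

Lemma prod_symdiff (F : 'I_n -> R) A B :
    (forall i, F i * F i = 1) ->
  \prod_(i in symdiff A B) F i = (\prod_(i in A) F i) * \prod_(i in B) F i.
Proof.
move=> F2; rewrite ![\prod_(i in _) F i]big_mkcond -big_split /=.
apply: eq_bigr => i _; rewrite in_symdiff.
by case: (i \in A); case: (i \in B); rewrite /= ?mulr1 ?mul1r ?F2.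
Qed.

Lemma csignDl A B C : csign (symdiff A B) C = csign A C * csign B C.
Proof.
apply: prod_symdiff => i; rewrite -big_split /= big1 // => j _.
by rewrite mulrNN mulr1.
Qed.

Lemma csignE A B :
  csign A B = \prod_(j in B) \prod_(i in A | (j <= i)%N) (-1).
Proof.
rewrite /csign.
under eq_bigr do rewrite big_mkcondr.
rewrite exchange_big /=.
by under eq_bigr do rewrite -big_mkcondr.
Qed.

Lemma csignDr A B C : csign A (symdiff B C) = csign A B * csign A C.
Proof.
rewrite !csignE; apply: prod_symdiff => i; rewrite -big_split /= big1 // => j _.
by rewrite mulrNN mulr1.
Qed.

Lemma ccoef_blade A B : ccoef (blade A) B = (A == B)%:R.
Proof. by rewrite /ccoef mxE eqxx /= (inj_eq enum_rank_inj) eq_sym. Qed.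

Lemma blade_sum a : a = \sum_A ccoef a A *: blade A.
Proof.
rewrite [LHS]row_sum_delta (reindex (@enum_rank {set 'I_n})) //=.
by exists enum_val => k _; rewrite ?enum_rankK ?enum_valK.
Qed.

Lemma cmul_blade A B : cmul (blade A) (blade B) = csign A B *: blade (symdiff A B).
Proof.
rewrite /cmul (bigD1 A) //= (bigD1 B) //= !ccoef_blade !eqxx !mulr1.
rewrite !big1 ?addr0 // => [C CA|C CB].
  apply: big1 => D _.
  by rewrite ccoef_blade eq_sym (negbTE CA) mulr0 mul0r scale0r.
by rewrite ccoef_blade eq_sym (negbTE CB) mulr0 scale0r.
Qed.

Lemma cmul_is_linearl b : linear (cmul^~ b).
Proof.
move=> k u v; rewrite /cmul scaler_sumr -big_split; apply: eq_bigr => A _ /=.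
rewrite scaler_sumr -big_split; apply: eq_bigr => B _ /=.
rewrite scalerA -scalerDl; congr (_ *: _).
by rewrite /ccoef !mxE mulrDr mulrDl !mulrA (mulrC k).
Qed.

Lemma cmul_is_linearr a : linear (cmul a).
Proof.
move=> k u v; rewrite /cmul scaler_sumr -big_split; apply: eq_bigr => A _ /=.
rewrite scaler_sumr -big_split; apply: eq_bigr => B _ /=.
rewrite scalerA -scalerDl; congr (_ *: _).
by rewrite /ccoef !mxE mulrDr mulrCA.
Qed.

Lemma linear_bladeP (f g : clifford R n -> clifford R n) :
  linear f -> linear g -> (forall A, f (blade A) = g (blade A)) -> f =1 g.
Proof.
move=> lf lg fg a.
pose F := GRing.isLinear.Build _ _ _ _ f lf.
pose G := GRing.isLinear.Build _ _ _ _ g lg.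
pose f' : {linear clifford R n -> clifford R n} := HB.pack f F.
pose g' : {linear clifford R n -> clifford R n} := HB.pack g G.
rewrite (blade_sum a) -[f _]/(f' _) -[g _]/(g' _) !linear_sum.
by apply: eq_bigr => A _; rewrite !linearZ; congr (_ *: _); exact: fg.
Qed.

Lemma cmulDl : left_distributive cmul +%R.
Proof.
by move=> a b c; have := cmul_is_linearl c 1 a b; rewrite /= !scale1r.
Qed.

Lemma cmulDr : right_distributive cmul +%R.
Proof.
by move=> a b c; have := cmul_is_linearr a 1 b c; rewrite !scale1r.
Qed.

Lemma cmulr0 a : cmul a 0 = 0.
Proof.
by apply: (addrI (cmul a 0)); rewrite -cmulDr !addr0.
Qed.

Lemma cmul0r a : cmul 0 a = 0.
Proof.
by apply: (addrI (cmul 0 a)); rewrite -cmulDl !addr0.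
Qed.

Lemma cmulZl k a b : cmul (k *: a) b = k *: cmul a b.
Proof.
by have := cmul_is_linearl b k a 0; rewrite /= !addr0 cmul0r addr0.
Qed.

Lemma cmulZr k a b : cmul a (k *: b) = k *: cmul a b.
Proof.
by have := cmul_is_linearr a k b 0; rewrite /= !addr0 cmulr0 addr0.
Qed.

Lemma cmulA : associative cmul.
Proof.
move=> a b c; move: a; apply: linear_bladeP => [k u v|k u v|A].
- by rewrite cmulDl cmulZl.
- by rewrite !(cmulDl, cmulZl).
move: b; apply: linear_bladeP => [k u v|k u v|B].
- by rewrite !(cmulDl, cmulDr, cmulZl, cmulZr).
- by rewrite !(cmulDl, cmulDr, cmulZl, cmulZr).
move: c; apply: linear_bladeP => [k u v|k u v|C].
- by rewrite !(cmulDr, cmulZr).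
- by rewrite !(cmulDr, cmulZr).
rewrite !cmul_blade cmulZr cmulZl !cmul_blade !scalerA symdiffA.
by rewrite csignDl csignDr mulrC mulrA.
Qed.

Lemma cmul1r : left_id cone cmul.
Proof.
apply: linear_bladeP => [k u v|k u v|A] //; first by rewrite cmulDr cmulZr.
by rewrite cmul_blade symdiff0l /csign big_set0 scale1r.
Qed.

Lemma cmulr1 : right_id cone cmul.
Proof.
apply: linear_bladeP => [k u v|k u v|A] //; first by rewrite cmulDl cmulZl.
by rewrite cmul_blade symdiff0r csignE big_set0 scale1r.
Qed.

Lemma cone_neq0 : cone != 0.
Proof.
apply/eqP => /(congr1 (ccoef^~ finset.set0)).
by rewrite ccoef_blade eqxx /ccoef mxE => /eqP; rewrite oner_eq0.
Qed.

HB.instance Definition _ := GRing.Zmodule_isNzRing.Build (clifford R n)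
  cmulA cmul1r cmulr1 cmulDl cmulDr cone_neq0.

Lemma clifford_scalerAl (k : R) a b : k *: (a * b) = k *: a * b.
Proof. by rewrite [RHS]cmulZl. Qed.

HB.instance Definition _ :=
  GRing.Lmodule_isLalgebra.Build R (clifford R n) clifford_scalerAl.

Lemma clifford_scalerAr (k : R) a b : k *: (a * b) = a * (k *: b).
Proof. by rewrite [RHS]cmulZr. Qed.

HB.instance Definition _ :=
  GRing.Lalgebra_isAlgebra.Build R (clifford R n) clifford_scalerAr.

(* Gives the ring inverse a^-1; as usual a^-1 = a when a is not a unit. *)
HB.instance Definition _ := Algebra_isFalgebra.Build R (clifford R n).

Definition cgen (i : 'I_n) : clifford R n := blade [set i]%SET.

Lemma cgen_sqr i : cgen i * cgen i = -1.
Proof.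
rewrite [LHS]cmul_blade /csign big_set1.
rewrite (big_pred1 i) => [|j]; last first.
  by rewrite inE /=; case: eqVneq => //= ->; rewrite leqnn.
rewrite scaleN1r; congr (- blade _).
by apply/setP => j; rewrite in_symdiff addbb inE.
Qed.

Lemma cgen_anticomm i j : i != j -> cgen i * cgen j = - (cgen j * cgen i).
Proof.
wlog ij : i j / (i < j)%N => [H neq|neq].
  have [ij|ji|/val_inj e] := ltngtP i j; first exact: H.
    by rewrite (H j i) ?opprK // eq_sym.
  by rewrite e eqxx in neq.
rewrite [LHS]cmul_blade [cgen j * _]cmul_blade /csign !big_set1.
rewrite big_pred0 => [|k]; last first.
  by rewrite inE /=; case: eqVneq => //= ->; rewrite leqNgt ij.
rewrite (big_pred1 i) => [|k]; last first.
  by rewrite inE /=; case: eqVneq => //= ->; rewrite ltnW.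
rewrite scaleN1r opprK scale1r; congr blade.
by apply/setP => k; rewrite !in_symdiff addbC.
Qed.

Lemma bladeE A : blade A = \prod_(i <- enum A) cgen i.
Proof.
have h (s : seq 'I_n) : sorted (fun i j : 'I_n => (i < j)%N) s ->
    \prod_(i <- s) cgen i = blade [set i in s]%SET.
  elim: s => [_|i s IH /= si].
    by rewrite big_nil; congr blade; apply/setP => i; rewrite !inE.
  have tr : transitive (fun i j : 'I_n => (i < j)%N).
    by move=> ? ? ?; exact: ltn_trans.
  have /allP lt_i := order_path_min tr si.
  rewrite big_cons IH ?(path_sorted si) // [LHS]cmul_blade /csign big_set1.
  rewrite big_pred0 => [|j]; last first.
    by rewrite inE; case: (boolP (j \in s)) => //= /lt_i; rewrite ltnNge => /negbTE.
  rewrite scale1r; congr blade; apply/setP => j.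
  rewrite in_symdiff !inE; case: eqVneq => //= ->.
  by case: (boolP (i \in s)) => // /lt_i; rewrite ltnn.
rewrite h; last first.
  have lt_tr : transitive (fun i j : 'I_n => (i < j)%N).
    by move=> ? ? ?; exact: ltn_trans.
  apply: (sorted_filter lt_tr); rewrite -enumT.
  have := iota_ltn_sorted 0 n.
  by rewrite -val_enum_ord sorted_map.
by congr blade; apply/setP => i; rewrite inE mem_enum.
Qed.

End CliffordProduct.

Arguments cgen {R n} i.

Section Paravectors.
Context {R : realType} {n : nat}.
Implicit Types s x : 'rV[R]_n.+1.

(* R^{n+1} is 'rV[R]_n.+1, with x_0 in column ord0 and the coefficient of
   cgen i in column lift ord0 i. *)

Definition pscal x : R := x 0 ord0.

Definition pvect x : 'rV[R]_n.+1 := x - pscal x *: delta_mx 0 ord0.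

Definition pconj x : 'rV[R]_n.+1 := pscal x *: delta_mx 0 ord0 - pvect x.

(* The library norm on row vectors is the sup norm. *)
Definition sqnorm x : R := \sum_i x 0 i ^+ 2.

Definition enorm x : R := Num.sqrt (sqnorm x).

Definition para x : clifford R n :=
  (pscal x)%:A + \sum_(i < n) x 0 (lift ord0 i) *: cgen i.

Definition imag_sphere : set 'rV[R]_n.+1 :=
  [set J | pscal J = 0 /\ enorm J = 1].

Definition psphere s : set 'rV[R]_n.+1 :=
  [set pscal s *: delta_mx 0 ord0 + enorm (pvect s) *: J | J in imag_sphere].

Definition Qc s x : clifford R n :=
  para s ^+ 2 - (2 * pscal x) *: para s + (sqnorm x)%:A.

Definition SLinv s x : clifford R n := (para s - para (pconj x)) * (Qc s x)^-1.

Definition SRinv s x : clifford R n := (Qc s x)^-1 * (para s - para (pconj x)).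

Definition partially_derivable (f : 'rV[R]_n.+1 -> clifford R n) x : Prop :=
  forall i : 'I_n.+1, derivable f x (delta_mx 0 i).

Definition partial (i : 'I_n.+1) (f : 'rV[R]_n.+1 -> clifford R n) x :
  clifford R n := 'D_(delta_mx 0 i) f x.

Definition diracL (f : 'rV[R]_n.+1 -> clifford R n) x : clifford R n :=
  partial ord0 f x + \sum_(i < n) cgen i * partial (lift ord0 i) f x.

Definition diracR (f : 'rV[R]_n.+1 -> clifford R n) x : clifford R n :=
  partial ord0 f x + \sum_(i < n) partial (lift ord0 i) f x * cgen i.

Definition SDLinv s x : clifford R n := diracL (SLinv s) x.

Definition SDRinv s x : clifford R n := diracR (SRinv s) x.

End Paravectors.

(* Main.v *)
Require Import Defs.
From mathcomp Require Import all_boot all_order all_algebra.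
From mathcomp Require Import all_classical all_reals all_analysis.
From mathcomp Require Import ring lra.

(** Write S for the paravector s, x_0 + V for the paravector x with V its
imaginary part, and T = S - x_0. Since V^2 = - |V|^2 is real, completing the
square in Q_{c,s}(x) = S^2 - 2 x_0 S + |x|^2 gives

  Q = T^2 - V^2,   S - conj x = T + V,   S_L^{-1} = (T + V) Q^{-1},

where T commutes with Q. The partial derivatives of Q are - 2 T in direction 0
and 2 x_i in direction i, while those of S - conj x are - 1 and e_i. With
D(Q^{-1}) = - Q^{-1} (DQ) Q^{-1}, the Dirac operator gives

  D S_L^{-1} = - Q^{-1} + 2 (T + V) T Q^{-2} - n Q^{-1} - 2 V (T + V) Q^{-2}
             = - (n + 1) Q^{-1} + 2 (T^2 - V^2) Q^{-2} = (1 - n) Q^{-1},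

because e_i^2 = -1 and the x_i e_i sum to V; the cross terms VT cancel without
any commutation between V and T. For n = 5 the factor is -4. The right-hand
statement is the mirror image. These purely algebraic cancellations are
[dirac_identityL] and [dirac_identityR].

What remains is that Q is invertible near x with a differentiable inverse. If
V_s is the imaginary part of s, then S is real plus V_s, so that Q = c + k V_s
with c and k = 2 (s_0 - x_0) real; hence Q (c - k V_s) = c^2 + k^2 |V_s|^2 is a
real number N, polynomial in x, and Q^{-1} = N^{-1} (c - k V_s) wherever N is
not zero. Finally N = 0 forces s_0 = x_0 and |V| = |V_s|, that is, x in [s]
([Qc_norm_neq0]). *)

Set Implicit Arguments.
Unset Strict Implicit.
Unset Printing Implicit Defensive.

Import Order.TTheory GRing.Theory Num.Theory.
Import numFieldNormedType.Exports.

Local Open Scope classical_set_scope.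
Local Open Scope ring_scope.

(** * Directional derivatives of Clifford-valued functions *)

Lemma is_derive_bigsum (R : numFieldType) (V W : normedModType R) (I : Type)
    (r : seq I) (h : I -> V -> W) (dh : I -> W) (x v : V) :
    (forall i, is_derive x v (h i) (dh i)) ->
  is_derive x v (fun y => \sum_(i <- r) h i y) (\sum_(i <- r) dh i).
Proof.
move=> dhE; rewrite -fct_sumE.
by elim/big_ind2 : _ => // [|] *; [exact: is_derive_cst|exact: is_deriveD].
Qed.

Lemma is_derive_scaler (R : numFieldType) (V W : normedModType R) (k : V -> R)
    (dk : R) (c : W) (x v : V) :
  is_derive x v k dk -> is_derive x v (fun y => k y *: c) (dk *: c).
Proof.
move=> [kd <-].
have lim : (fun h => h^-1 *: (((fun y => k y *: c) \o shift x) (h *: v)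
    - k x *: c)) @ 0^' --> 'D_v k x *: c.
  rewrite (_ : (fun h => _) =
    (fun h => (h^-1 *: ((k \o shift x) (h *: v) - k x)) *: c)); last first.
    by apply/funext => h; rewrite /= -scalerBl scalerA.
  exact: cvgZr_tmp.
by split; [apply/cvg_ex; exists ('D_v k x *: c) | exact: cvg_lim lim].
Qed.

Lemma is_derive_entry (R : realFieldType) (V : normedModType R) (m n : nat)
    (M : V -> 'M[R]_(m, n)) (dM : 'M[R]_(m, n)) (x v : V) i j :
  is_derive x v M dM -> is_derive x v (fun y => M y i j) (dM i j).
Proof.
move=> [Md <-]; split; first by move/derivable_mxP : Md; apply.
by rewrite derive_mx // mxE.
Qed.

(** The Leibniz rule holds because, in the basis of blades, the product is a
finite sum of products of real coordinates with constant coefficients. The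
order of the factors is kept. *)
Lemma is_derive_cliffM (R : realType) (n : nat) (V : normedModType R)
    (f g : V -> clifford R n) (df dg : clifford R n) (x v : V) :
    is_derive x v f df -> is_derive x v g dg ->
  is_derive x v (fun y => f y * g y) (df * g x + f x * dg).
Proof.
move=> fd gd.
have fcd A : is_derive x v (fun y => ccoef (f y) A) (ccoef df A).
  exact: is_derive_entry.
have gcd A : is_derive x v (fun y => ccoef (g y) A) (ccoef dg A).
  exact: is_derive_entry.
have -> : df * g x + f x * dg = \sum_A \sum_B
   (csign A B * (ccoef df A * ccoef (g x) B + ccoef (f x) A * ccoef dg B))
     *: blade (symdiff A B).
  rewrite -[df * _]/(cmul _ _) -[f x * _]/(cmul _ _) /cmul -big_split.
  apply: eq_bigr => A _; rewrite -big_split; apply: eq_bigr => B _ /=.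
  by rewrite -scalerDl mulrDr !mulrA.
apply: is_derive_bigsum => A; apply: is_derive_bigsum => B.
apply: is_derive_scaler.
have := is_deriveZ (csign A B) (is_deriveM (fcd A) (gcd B)).
congr (is_derive x v _ _) => /=.
  by apply/funext => y /=; rewrite -[LHS]/(_ * (_ * _)) mulrA.
by rewrite /GRing.scale /=; congr (_ * _); rewrite addrC mulrC.
Qed.

(** Once f^-1 is known to be derivable, its derivative is forced by applying the
Leibniz rule to f * f^-1 = 1. *)
Lemma is_derive_cliffV (R : realType) (n : nat) (V : normedModType R)
    (f : V -> clifford R n) (df : clifford R n) (x v : V) :
    (\near x, f x \is a GRing.unit) ->
    is_derive x v f df -> derivable (fun y => (f y)^-1) x v ->
  is_derive x v (fun y => (f y)^-1) (- ((f x)^-1 * df * (f x)^-1)).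
Proof.
move=> fU fd /derivableP gd; have fxU := nbhs_singleton fU.
split; first exact: ex_derive.
have p1 : is_derive x v (fun=> 1 : clifford R n)
    (df * (f x)^-1 + f x * 'D_v (fun y => (f y)^-1) x).
  apply: (near_eq_is_derive _ (is_derive_cliffM fd gd)).
  by apply: filterS fU => y /divrr.
have := @derive_val _ _ _ _ _ _ _ p1; rewrite derive_cst => /esym/eqP.
rewrite addrC addr_eq0 => /eqP e.
by apply: (mulrI fxU); rewrite e mulrN !mulrA mulrV // mul1r.
Qed.

(** * Algebraic identities *)

(** Adding the double sum V^2 to its transpose leaves only the diagonal, since
e i * e j + e j * e i vanishes for distinct i and j. *)
Lemma sqr_sum_anticomm (R : numFieldType) (A : algType R) (n : nat)
    (e : 'I_n -> A) (c : 'I_n -> R) :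
    (forall i, e i * e i = -1) ->
    (forall i j, i != j -> e i * e j = - (e j * e i)) ->
  (\sum_(i < n) c i *: e i) ^+ 2 = - (\sum_(i < n) c i ^+ 2)%:A.
Proof.
move=> esqr eanti; set V := \sum_(i < n) _; set q : A := _%:A.
have VE : V ^+ 2 = \sum_(i < n) \sum_(j < n) (c i * c j) *: (e i * e j).
  rewrite expr2 {1}/V mulr_suml; apply: eq_bigr => i _.
  rewrite mulr_sumr; apply: eq_bigr => j _.
  by rewrite -scalerAl -scalerAr scalerA.
have V2 : V ^+ 2 *+ 2 = - q *+ 2.
  rewrite mulr2n {1}VE [X in _ + X]VE [X in _ + X]exchange_big /= -big_split /=.
  rewrite mulNrn /q scaler_suml -sumrMnl -sumrN.
  apply: eq_bigr => i _; rewrite -big_split /= (bigD1 i) //= big1 ?addr0.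
    by rewrite esqr scalerN -opprD expr2 mulr2n.
  move=> j ij; rewrite [c j * _]mulrC -scalerDr.
  by rewrite [e i * e j]eanti 1?eq_sym // addNr scaler0.
have two_neq0 : 2%:R != 0 :> R by rewrite pnatr_eq0.
by apply: (scalerI two_neq0); rewrite [LHS]scaler_nat [RHS]scaler_nat.
Qed.

(** An element of R + R V, where V^2 is a real number, is inverted through its
conjugate c - k V as in the complex numbers. *)
Lemma quadratic_inv (R : fieldType) (A : unitAlgType R) (V : A) (r c k : R) :
    V ^+ 2 = - r%:A -> c ^+ 2 + k ^+ 2 * r != 0 ->
  c%:A + k *: V \is a GRing.unit /\
  (c%:A + k *: V)^-1 = (c ^+ 2 + k ^+ 2 * r)^-1 *: (c%:A - k *: V).
Proof.
move=> Vsqr; set N := _ + _ => N0; set q := c%:A + _; set q' := c%:A - _.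
have cV : GRing.comm c%:A (k *: V) by rewrite /GRing.comm mulr_algl mulr_algr.
have cq : GRing.comm q q'.
  by apply: commrB; apply/commr_sym/commrD => //; apply/commr_sym.
have qq' : q * q' = N%:A.
  rewrite -[RHS]/((c ^+ 2 + k ^+ 2 * r) *: 1) mulrDl !mulrBr -cV addrA subrK.
  rewrite -[_ * c%:A]expr2 -[_ * (k *: V)]expr2 !exprZn expr1n Vsqr.
  by rewrite scalerN opprK scalerA scalerDl.
have h1 : q * (N^-1 *: q') = 1 by rewrite -scalerAr qq' scalerA mulVf ?scale1r.
have h2 : (N^-1 *: q') * q = 1.
  by rewrite -scalerAl -cq qq' scalerA mulVf ?scale1r.
have qU : q \is a GRing.unit by apply/unitrP; exists (N^-1 *: q').
by split=> //; apply: (mulrI qU); rewrite h1 mulrV.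
Qed.

Lemma sqrrB_scalar (R : comNzRingType) (A : algType R) (a : A) (k : R) :
  (a - k%:A) ^+ 2 = a ^+ 2 - (2 * k) *: a + (k ^+ 2)%:A.
Proof.
rewrite expr2 mulrBr mulr_algr mulrBl mulr_algl scalerBr scalerA opprB addrA.
by rewrite addrAC -[_ - _ - _]addrA -opprD -scalerDl mulr_natl mulr2n !expr2.
Qed.

Section DiracIdentity.
Context {R : fieldType} {A : unitAlgType R} {n : nat}.
Context (e : 'I_n -> A) (c : 'I_n -> R) (T Q : A).
Let V := \sum_(i < n) c i *: e i.
Context (esqr : forall i, e i * e i = -1) (QE : Q = T ^+ 2 - V ^+ 2).
Context (TQ : GRing.comm T Q) (QU : Q \is a GRing.unit).

Let TQV : GRing.comm T Q^-1. Proof. exact: commrV. Qed.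

(** The left-hand side is what the Dirac operator, acting from the left, makes
of the product and quotient rules for (T + V) * Q^-1, when the numerator has
partial derivatives - 1 and e i, and Q has - (2 *: T) and (2 * c i)%:A. The sum
over i turns the second group of terms into V * (T + V) * Q^-1 ^+ 2, and
(T + V) * T - V * (T + V) = T ^+ 2 - V ^+ 2 restores a factor Q. *)
Lemma dirac_identityL :
  (- Q^-1 - (T + V) * (Q^-1 * - (2 *: T) * Q^-1)) +
    \sum_(i < n) e i * (e i * Q^-1 - (T + V) * (Q^-1 * (2 * c i)%:A * Q^-1)) =
  (1 - n%:R) *: Q^-1.
Proof.
set W := (T + V) * (Q^-1 * Q^-1).
have -> : (T + V) * (Q^-1 * - (2 *: T) * Q^-1) =
    - (2 *: ((T + V) * T * (Q^-1 * Q^-1))).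
  by rewrite mulrN mulNr mulrN -scalerAr -scalerAl -scalerAr -TQV !mulrA.
under eq_bigr => i _.
  rewrite mulr_algr -scalerAl -scalerAr -/W mulrBr mulrA esqr mulN1r -scalerAr.
  rewrite -scalerA [c i *: _]scalerAl.
  over.
rewrite /= sumrB sumr_const card_ord -scaler_sumr -mulr_suml -/V.
rewrite /W [V * _]mulrA opprK.
rewrite addrACA -scalerBr -mulrBl.
have -> : (T + V) * T - V * (T + V) = Q.
  by rewrite QE mulrDl mulrDr opprD addrA addrK !expr2.
rewrite mulrA mulrV // mul1r -scaler_nat scalerN -{1}[Q^-1]scale1r.
rewrite -!scaleNr -!scalerDl; congr (_ *: _); ring.
Qed.

(** Mirror image of [dirac_identityL]: here Q is recovered from
T * (T + V) - (T + V) * V. *)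
Lemma dirac_identityR :
  (- Q^-1 - Q^-1 * - (2 *: T) * Q^-1 * (T + V)) +
    \sum_(i < n) (Q^-1 * e i - Q^-1 * (2 * c i)%:A * Q^-1 * (T + V)) * e i =
  (1 - n%:R) *: Q^-1.
Proof.
set W := Q^-1 * Q^-1 * (T + V).
have -> : Q^-1 * - (2 *: T) * Q^-1 * (T + V) =
    - (2 *: (Q^-1 * Q^-1 * (T * (T + V)))).
  rewrite mulrN !mulNr -scalerAr -!scalerAl; congr (- (_ *: _)).
  by rewrite -[Q^-1 * T * _]mulrA TQV !mulrA.
under eq_bigr => i _.
  rewrite mulr_algr -!scalerAl -/W mulrBl -mulrA esqr mulrN1 -scalerAl.
  rewrite -scalerA scalerAr.
  over.
rewrite /= sumrB sumr_const card_ord -scaler_sumr -mulr_sumr -/V.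
rewrite /W -[_ * V]mulrA opprK.
rewrite addrACA -scalerBr -mulrBr.
have -> : T * (T + V) - (T + V) * V = Q.
  by rewrite QE mulrDl mulrDr opprD addrA addrK !expr2.
rewrite -mulrA mulVr // mulr1 -scaler_nat scalerN -{1}[Q^-1]scale1r.
rewrite -!scaleNr -!scalerDl; congr (_ *: _); ring.
Qed.

End DiracIdentity.

(** * The quadratic polynomial of the Cauchy kernels *)

Section Paravectors.
Context {R : realType} {n : nat}.
Implicit Types s x v : 'rV[R]_n.+1.

Definition imag x : clifford R n := \sum_(i < n) x 0 (lift ord0 i) *: cgen i.

Definition imag_sqnorm x : R := \sum_(i < n) x 0 (lift ord0 i) ^+ 2.

Lemma para_pconj x : para (pconj x) = (pscal x)%:A - imag x.
Proof.
rewrite /para /pconj /pvect /pscal !mxE eqxx /= !mulr1 subrr subr0.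
congr (_ + _); rewrite -sumrN; apply: eq_bigr => i _.
by rewrite !mxE eqxx /= mulr0 subr0 sub0r scaleNr.
Qed.

Lemma sqnormE x : sqnorm x = pscal x ^+ 2 + imag_sqnorm x.
Proof. by rewrite /sqnorm big_ord_recl. Qed.

Lemma imag_sqnorm_ge0 x : 0 <= imag_sqnorm x.
Proof. by apply: sumr_ge0 => i _; exact: sqr_ge0. Qed.

Lemma imag_sqr x : imag x ^+ 2 = - (imag_sqnorm x)%:A.
Proof. exact: sqr_sum_anticomm cgen_sqr cgen_anticomm. Qed.

Lemma sqnorm_pvect x : sqnorm (pvect x) = imag_sqnorm x.
Proof.
rewrite sqnormE /pscal /pvect !mxE !eqxx /= mulr1 subrr expr0n add0r.
by apply: eq_bigr => i _; rewrite !mxE eqxx /= mulr0 subr0.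
Qed.

(** Completing the square: with T the real translate of s by - x_0, this is
Q = T^2 - V^2. *)
Lemma Qc_sqrB s x : Qc s x = (para s - (pscal x)%:A) ^+ 2 - imag x ^+ 2.
Proof.
rewrite imag_sqr opprK sqrrB_scalar -[RHS]addrA; congr (_ + _).
by rewrite sqnormE scalerDl.
Qed.

(** The real part of Qc s x once it is written as a combination of 1 and imag s;
see [Qc_linear]. *)
Definition Qc_real s x : R :=
  (pscal s - pscal x) ^+ 2 - imag_sqnorm s + imag_sqnorm x.

(** The product of Qc s x with its conjugate in R + R (imag s). It is real, and
polynomial in x, hence its zero set carries all questions of invertibility and
differentiability of the inverse of Qc s x. *)
Definition Qc_norm s x : R :=
  Qc_real s x ^+ 2 + (2 * (pscal s - pscal x)) ^+ 2 * imag_sqnorm s.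

Lemma Qc_linear s x :
  Qc s x = (Qc_real s x)%:A + (2 * (pscal s - pscal x)) *: imag s.
Proof.
(* para s - x_0 = imag s - (x_0 - s_0), and the square of imag s is real. *)
have -> : Qc s x = (imag s - (pscal x - pscal s)%:A) ^+ 2 + (imag_sqnorm x)%:A.
  rewrite Qc_sqrB imag_sqr opprK; congr (_ ^+ 2 + _).
  by rewrite scalerBl opprB addrA [imag s + _]addrC.
rewrite sqrrB_scalar imag_sqr -[pscal x - pscal s]opprB.
rewrite mulrN scaleNr opprK sqrrN.
rewrite /Qc_real scalerDl scalerBl [- _ + _]addrC [RHS]addrC !addrA.
by congr (_ + _); rewrite addrAC.
Qed.

Lemma Qc_unit s x : Qc_norm s x != 0 -> Qc s x \is a GRing.unit.
Proof. by rewrite Qc_linear => N0; case: (quadratic_inv (imag_sqr s) N0). Qed.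

Lemma Qc_inv s x : Qc_norm s x != 0 ->
  (Qc s x)^-1 = (Qc_norm s x)^-1 *:
    ((Qc_real s x)%:A - (2 * (pscal s - pscal x)) *: imag s).
Proof. by rewrite Qc_linear => N0; case: (quadratic_inv (imag_sqr s) N0). Qed.

(** * Derivatives of the Cauchy kernels *)

Lemma differentiable_Qc_real s x : differentiable (Qc_real s) x.
Proof.
have -> : Qc_real s = (cst (pscal s) - pscal) ^+ 2 - cst (imag_sqnorm s) +
    \sum_(i < n) (fun y : 'rV[R]_n.+1 => y 0 (lift ord0 i)) ^+ 2.
  by apply/funext => y; rewrite /Qc_real /= -[RHS]/(_ - _ + _) fct_sumE.
have coord i : differentiable (fun y : 'rV[R]_n.+1 => y 0 i) x.
  exact: differentiable_coord.
apply: differentiableD; last first.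
  by apply: differentiable_sum => i; exact: differentiableX.
apply: differentiableB; last exact: differentiable_cst.
apply: differentiableX; apply: differentiableB; first exact: differentiable_cst.
exact: coord.
Qed.

Lemma differentiable_Qc_norm s x : differentiable (Qc_norm s) x.
Proof.
have -> : Qc_norm s = Qc_real s ^+ 2 +
    (2 \*: (cst (pscal s) - pscal)) ^+ 2 * cst (imag_sqnorm s) by [].
apply: differentiableD; first exact/differentiableX/differentiable_Qc_real.
apply: differentiableM; last exact: differentiable_cst.
apply: differentiableX; apply: differentiableZ; apply: differentiableB.
  exact: differentiable_cst.
exact: differentiable_coord.
Qed.

Lemma Qc_norm_neq0_near s x : Qc_norm s x != 0 -> \near x, Qc_norm s x != 0.
Proof.
move=> N0.
have cN := differentiable_continuous (differentiable_Qc_norm s x).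
exact: (cvgr_neq0 (Qc_norm s x) cN N0).
Qed.

Lemma is_derive_pscal x v : is_derive x v pscal (pscal v).
Proof. exact: (is_derive_entry 0 ord0 (is_derive_id x v)). Qed.

(** Near x the inverse is given by [Qc_inv], whose coefficients on the fixed
elements 1 and imag s are rational functions with denominator Qc_norm s. *)
Lemma derivable_Qc_inv s x v :
  Qc_norm s x != 0 -> derivable (fun y => (Qc s y)^-1) x v.
Proof.
move=> N0.
suff [] : is_derive x v (fun y => (Qc s y)^-1)
   ('D_v (fun y => (Qc_norm s y)^-1 * Qc_real s y) x *: 1 -
    'D_v (fun y => (Qc_norm s y)^-1 * (2 * (pscal s - pscal y))) x *: imag s).
  by [].
apply: (near_eq_is_derive (f := fun y =>
    ((Qc_norm s y)^-1 * Qc_real s y) *: 1 -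
    ((Qc_norm s y)^-1 * (2 * (pscal s - pscal y))) *: imag s)).
  near=> y; rewrite Qc_inv; last by near: y; exact: Qc_norm_neq0_near.
  by rewrite scalerBr !scalerA.
have Nd : derivable (fun y => (Qc_norm s y)^-1) x v.
  by apply: derivableV => //; exact/diff_derivable/differentiable_Qc_norm.
apply: is_deriveB; apply: is_derive_scaler; apply: derivableP.
  by apply: (derivableM Nd); exact/diff_derivable/differentiable_Qc_real.
apply: (derivableM Nd).
apply: (@derivableZ _ _ _ (fun y => pscal s - pscal y)).
apply: (@derivableB _ _ _ (cst (pscal s)) pscal); first exact: derivable_cst.
by have [] := is_derive_pscal x v.
Unshelve. all: by end_near. Qed.

(** The directional derivative of Qc s at x along v, by [is_derive_Qc]. *)
Definition dQc s x v : clifford R n :=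
  (\sum_i 2 * x 0 i * v 0 i)%:A - (2 * pscal v) *: para s.

Lemma is_derive_Qc s x v : is_derive x v (Qc s) (dQc s x v).
Proof.
rewrite /dQc addrC -[- (_ *: _)]sub0r.
apply: (@is_deriveD _ _ _ (fun y => para s ^+ 2 - (2 * pscal y) *: para s)
  (fun y => (sqnorm y)%:A)).
  apply: (@is_deriveB _ _ _ (cst (para s ^+ 2))
    (fun y => (2 * pscal y) *: para s)).
  apply: is_derive_scaler.
  exact: (@is_deriveZ _ _ _ pscal 2 _ _ _ (is_derive_pscal x v)).
apply: is_derive_scaler; apply: is_derive_bigsum => i.
have d := is_derive_entry 0 i (is_derive_id x v).
have := is_deriveX 2 d.
by rewrite expr1.
Qed.

Lemma is_derive_para_pconj x v :
  is_derive x v (fun y => para (pconj y)) (para (pconj v)).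
Proof.
rewrite (_ : (fun _ => _) = (fun y => (pscal y)%:A - imag y)); last first.
  by apply/funext => y; rewrite para_pconj.
rewrite para_pconj.
apply: (@is_deriveB _ _ (clifford R n) (fun y => (pscal y)%:A) imag).
  exact/is_derive_scaler/is_derive_pscal.
apply: is_derive_bigsum => i; apply: is_derive_scaler.
exact: (is_derive_entry _ _ (is_derive_id x v)).
Qed.

Lemma is_derive_Qc_inv s x v : Qc_norm s x != 0 ->
  is_derive x v (fun y => (Qc s y)^-1)
    (- ((Qc s x)^-1 * dQc s x v * (Qc s x)^-1)).
Proof.
move=> N0.
apply: (is_derive_cliffV _ (is_derive_Qc s x v)); last exact: derivable_Qc_inv.
by near=> y; apply: Qc_unit; near: y; exact: Qc_norm_neq0_near.
Unshelve. all: by end_near. Qed.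

Lemma is_derive_SLnum s x v :
  is_derive x v (fun y => para s - para (pconj y)) (- para (pconj v)).
Proof.
rewrite -[- para _]sub0r.
apply: (@is_deriveB _ _ _ (cst (para s)) (fun y => para (pconj y))).
exact: is_derive_para_pconj.
Qed.

Lemma is_derive_SLinv s x v : Qc_norm s x != 0 ->
  is_derive x v (SLinv s) (- para (pconj v) * (Qc s x)^-1 -
    (para s - para (pconj x)) * ((Qc s x)^-1 * dQc s x v * (Qc s x)^-1)).
Proof.
move=> N0; rewrite -mulrN.
exact: is_derive_cliffM (is_derive_SLnum s x v) (is_derive_Qc_inv v N0).
Qed.

Lemma is_derive_SRinv s x v : Qc_norm s x != 0 ->
  is_derive x v (SRinv s) (- (Qc s x)^-1 * para (pconj v) -
    (Qc s x)^-1 * dQc s x v * (Qc s x)^-1 * (para s - para (pconj x))).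
Proof.
move=> N0.
have := is_derive_cliffM (is_derive_Qc_inv v N0) (is_derive_SLnum s x v).
by rewrite addrC !mulNr mulrN.
Qed.

Lemma pscal_delta0 : pscal (delta_mx 0 ord0 : 'rV[R]_n.+1) = 1.
Proof. by rewrite /pscal mxE !eqxx. Qed.

Lemma pscal_delta_lift i : pscal (delta_mx 0 (lift ord0 i) : 'rV[R]_n.+1) = 0.
Proof. by rewrite /pscal mxE !eqxx. Qed.

Lemma imag_delta0 : imag (delta_mx 0 ord0) = 0.
Proof. by rewrite /imag big1 // => j _; rewrite mxE eqxx /= scale0r. Qed.

Lemma imag_delta_lift i : imag (delta_mx 0 (lift ord0 i)) = cgen i.
Proof.
rewrite /imag (bigD1 i) //= big1 ?addr0 => [|j ji].
  by rewrite mxE !eqxx /= scale1r.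
by rewrite mxE eqxx /= (inj_eq lift_inj) (negbTE ji) scale0r.
Qed.

Lemma dQc_delta s x i : dQc s x (delta_mx 0 i) =
  (2 * x 0 i)%:A - (2 * pscal (delta_mx 0 i : 'rV[R]_n.+1)) *: para s.
Proof.
rewrite /dQc (bigD1 i) //= big1 ?addr0 => [|j ji].
  by rewrite !mxE !eqxx /= mulr1.
by rewrite !mxE eqxx (negbTE ji) /= mulr0.
Qed.

Lemma dQc_delta0 s x :
  dQc s x (delta_mx 0 ord0) = - (2 *: (para s - (pscal x)%:A)).
Proof. by rewrite dQc_delta pscal_delta0 mulr1 scalerBr opprB scalerA. Qed.

Lemma dQc_delta_lift s x i :
  dQc s x (delta_mx 0 (lift ord0 i)) = (2 * x 0 (lift ord0 i))%:A.
Proof. by rewrite dQc_delta pscal_delta_lift mulr0 scale0r subr0. Qed.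

Lemma SLnumE s x :
  para s - para (pconj x) = (para s - (pscal x)%:A) + imag x.
Proof. by rewrite para_pconj opprB addrA addrAC. Qed.

Lemma comm_Qc s x : GRing.comm (para s - (pscal x)%:A) (Qc s x).
Proof.
rewrite Qc_sqrB imag_sqr opprK; apply: commrD; first exact: commrX.
by rewrite /GRing.comm mulr_algl mulr_algr.
Qed.

(** The derivatives of the numerator contribute - (n + 1) and those of the
denominator contribute 2. *)
Theorem diracL_SLinv s x : Qc_norm s x != 0 ->
  SDLinv s x = (1 - n%:R) *: (Qc s x)^-1.
Proof.
move=> N0.
rewrite -(dirac_identityL (c := fun i => x 0 (lift ord0 i)) (@cgen_sqr R n)
  (Qc_sqrB s x) (comm_Qc s x) (Qc_unit N0)).
rewrite /SDLinv /diracL /partial.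
rewrite (@derive_val _ _ _ _ _ _ _ (is_derive_SLinv _ N0)).
rewrite dQc_delta0 para_pconj pscal_delta0 imag_delta0 subr0 scale1r mulN1r.
rewrite SLnumE; congr (_ + _).
apply: eq_bigr => i _.
rewrite (@derive_val _ _ _ _ _ _ _ (is_derive_SLinv _ N0)).
rewrite dQc_delta_lift para_pconj pscal_delta_lift imag_delta_lift.
by rewrite scale0r sub0r opprK SLnumE.
Qed.

Theorem diracR_SRinv s x : Qc_norm s x != 0 ->
  SDRinv s x = (1 - n%:R) *: (Qc s x)^-1.
Proof.
move=> N0.
rewrite -(dirac_identityR (c := fun i => x 0 (lift ord0 i)) (@cgen_sqr R n)
  (Qc_sqrB s x) (comm_Qc s x) (Qc_unit N0)).
rewrite /SDRinv /diracR /partial.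
rewrite (@derive_val _ _ _ _ _ _ _ (is_derive_SRinv _ N0)).
rewrite dQc_delta0 para_pconj pscal_delta0 imag_delta0 subr0 scale1r mulr1.
rewrite SLnumE; congr (_ + _).
apply: eq_bigr => i _.
rewrite (@derive_val _ _ _ _ _ _ _ (is_derive_SRinv _ N0)).
rewrite dQc_delta_lift para_pconj pscal_delta_lift imag_delta_lift.
by rewrite scale0r sub0r mulrN mulNr opprK SLnumE.
Qed.

End Paravectors.

(** * Invertibility outside the sphere of s *)

Lemma mem_psphere (R : realType) (n : nat) (s x : 'rV[R]_n.+2) :
    pscal x = pscal s -> imag_sqnorm x = imag_sqnorm s -> psphere s x.
Proof.
move=> x0 xv; rewrite /psphere /= /enorm sqnorm_pvect.
have [s0|s_neq0] := eqVneq (imag_sqnorm s) 0.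
  (* Here [s] is the point s_0, so any imaginary unit is a witness. *)
  exists (delta_mx 0 (lift ord0 ord0)).
    split; first exact: pscal_delta_lift.
    rewrite /enorm sqnormE pscal_delta_lift expr0n add0r /imag_sqnorm.
    rewrite big_ord_recl big1 ?addr0 => [|i _].
      by rewrite mxE !eqxx expr1n sqrtr1.
    by rewrite mxE eqxx expr0n.
  rewrite s0 sqrtr0 scale0r addr0; apply/rowP => i; rewrite !mxE eqxx /=.
  have [j ->|->] := unliftP ord0 i; last by rewrite eqxx mulr1 -x0.
  rewrite mulr0; move: xv; rewrite s0 => /eqP.
  rewrite psumr_eq0 => [|k _]; last exact: sqr_ge0.
  move=> /allP /(_ j); rewrite mem_index_enum /= sqrf_eq0.
  by move=> /(_ isT) /eqP ->.
set r := Num.sqrt _.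
have r_gt0 : 0 < r by rewrite sqrtr_gt0 lt_neqAle eq_sym s_neq0 imag_sqnorm_ge0.
exists (r^-1 *: pvect x).
  split; first by rewrite /pscal !mxE !eqxx mulr1 subrr mulr0.
  rewrite /enorm.
  have -> : sqnorm (r^-1 *: pvect x) = r ^- 2 * sqnorm (pvect x).
    rewrite /sqnorm mulr_sumr; apply: eq_bigr => i _.
    by rewrite mxE exprMn exprVn.
  rewrite sqnorm_pvect xv -(sqr_sqrtr (imag_sqnorm_ge0 s)) -/r.
  by rewrite mulVf ?sqrtr1 // expf_neq0 // gt_eqF.
by rewrite scalerA divff ?gt_eqF // scale1r -x0 /pvect addrC subrK.
Qed.

(** If c^2 + k^2 |V_s|^2 = 0 with k = 2 (s_0 - x_0), then c = 0, and k = 0 or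
V_s = 0. In the latter case c is the sum of squares (s_0 - x_0)^2 + |V_x|^2, so
that k = 0 again. Thus s_0 = x_0 and c = |V_x|^2 - |V_s|^2 = 0. *)
Lemma Qc_norm_neq0 (R : realType) (n : nat) (s x : 'rV[R]_n.+2) :
  ~ psphere s x -> Qc_norm s x != 0.
Proof.
move=> xs; apply/negP => N0; apply: xs.
have xge := imag_sqnorm_ge0 x; have sge := imag_sqnorm_ge0 s.
have dge := sqr_ge0 (pscal s - pscal x).
move: N0.
rewrite /Qc_norm (paddr_eq0 (sqr_ge0 _) (mulr_ge0 (sqr_ge0 _) sge)).
rewrite sqrf_eq0 mulf_eq0 sqrf_eq0 mulf_eq0 pnatr_eq0 /= /Qc_real.
move=> /andP[/eqP c0 d0].
have s0x0 : pscal s - pscal x = 0.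
  case/orP: d0 => [/eqP //|/eqP sv0].
  by apply/eqP; rewrite -sqrf_eq0; apply/eqP; lra.
by apply: mem_psphere; [lra|move: c0; rewrite s0x0; lra].
Qed.

Theorem theorem6p10 (R : realType) (s x : 'rV[R]_6) (hx : ~ psphere s x) :
  (partially_derivable (SLinv s) x /\
   SDLinv s x = (- 4) *: (Qc s x)^-1) /\
  (partially_derivable (SRinv s) x /\
   SDRinv s x = (- 4) *: (Qc s x)^-1).
Proof.
have N0 := Qc_norm_neq0 hx.
have e4 : 1 - 5%:R = - 4 :> R by lra.
split; split.
- by move=> i; have [] := is_derive_SLinv (delta_mx 0 i) N0.
- by rewrite diracL_SLinv // e4.
- by move=> i; have [] := is_derive_SRinv (delta_mx 0 i) N0.
- by rewrite diracR_SRinv // e4.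
Qed.
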